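(* Let $\delta:\{\bullet,\bullet\}\to\{\bullet\}$ be the map from the discrete two-point space to the one-point space. The following hold in the category of all topological spaces. (1) A space $X$ is connected iff $(X\to\{\bullet\})\in\{\delta\}^{l}$. (2) A map $X\to Q$ lies in $\{\delta\}^{l}$ iff each clopen subset of $X$ is the preimage of a clopen subset of $Q$. In particular, this holds if either $X$ is connected, or $X\to Q$ is a quotient map with connected fibres. If $\pi_0(Q)$ is discrete, then $(X\to Q)\in\{\delta\}^l$ is equivalent to $\pi_0(X)\to\pi_0(Q)$ being injective. (3) A space $Q$ is a retract of $\{\bullet,\bullet\}^{\kappa}$ for some ordinal $\kappa$ iff $(Q\to\{\bullet\})\in\{\delta\}^{lr}$. In particular, such a space $Q$ is necessarily totally disconnected, compact and Hausdorff. (4) A metrisable space $Q$ is profinite, or equivalently totally disconnected compact Hausdorff, iff $(Q\to\{\bullet\})\in\{\delta\}^{lr}$. (5) Each continuous map $f:X\to Y$ factors as $X\xrightarrow{f_l}Q\xrightarrow{f_{lr}}Y$ with $f_l\in\{\delta\}^{l}$ and $f_{lr}\in\{\delta\}^{lr}$.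
   Context: All maps are continuous. A map $f:A\to B$ has the left lifting property with respect to $g:X\to Y$ (equivalently $g$ has the right lifting property with respect to $f$), written $f\pitchfork g$, if for all $t:A\to X$, $s:B\to Y$ with $g\circ t=s\circ f$ there is $h:B\to X$ with $h\circ f=t$ and $g\circ h=s$. For a class $P$ of maps, $P^l=\{f:\ f\pitchfork g \text{ for all } g\in P\}$, $P^r=\{g:\ f\pitchfork g\text{ for all } f\in P\}$, and $P^{lr}=(P^l)^r$. A space is connected iff it is not the union of two disjoint non-empty open subsets (so the empty space counts as connected). $\pi_0(X)$ is the set of connected components of $X$ with the quotient topology. $\{\bullet,\bullet\}^\kappa$ is the product of $\kappa$ copies of the discrete two-point space with the product topology.
   Formalization: In (4), the equivalence of profinite with (Q → point) lying in {δ}^{lr} is stated for non-empty Q only, since the empty space is metrisable and profinite but its map to the point is in {δ}^l and not in {δ}^{lr}. *)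

(* Defs.v *)
From HB Require Import structures.
From mathcomp Require Import all_boot all_order all_algebra.
From mathcomp Require Import all_classical all_reals all_analysis.
From mathcomp Require Import wochoice.

Set Implicit Arguments.
Unset Strict Implicit.
Unset Printing Implicit Defensive.

Local Open Scope classical_set_scope.
Local Open Scope quotient_scope.

Definition map_class := forall X Y : topologicalType, set (X -> Y).

Definition lifts (A B X Y : topologicalType) (f : A -> B) (g : X -> Y) : Prop :=
  forall (t : A -> X) (s : B -> Y), continuous t -> continuous s ->
    g \o t = s \o f ->
    exists h : B -> X, [/\ continuous h, h \o f = t & g \o h = s].

Definition left_class (P : map_class) : map_class := fun A B f =>
  continuous f /\
  forall (X Y : topologicalType) (g : X -> Y), P X Y g -> lifts f g.

Definition right_class (P : map_class) : map_class := fun X Y g =>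
  continuous g /\
  forall (A B : topologicalType) (f : A -> B), P A B f -> lifts f g.

Inductive class1 (A B : topologicalType) (f : A -> B) :
  forall X Y : topologicalType, (X -> Y) -> Prop :=
| Class1 : class1 f f.

(* MathComp-Analysis puts no topology on [unit]; [bool] is discrete. *)
Definition point_space : topologicalType := discrete_topology unit.

Definition to_point (X : topologicalType) : X -> point_space := fun=> tt.

Definition delta : bool -> point_space := to_point (X := bool).

Definition delta_l : map_class := left_class (class1 delta).

Definition delta_lr : map_class := right_class delta_l.

Definition discrete_space (X : topologicalType) : Prop :=
  forall A : set X, open A.

Definition quotient_map (X Y : topologicalType) (f : X -> Y) : Prop :=
  [/\ continuous f, set_surj setT setT f &
      forall V : set Y, open (f @^-1` V) -> open V].

Definition homeomorphic (X Y : topologicalType) : Prop :=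
  exists (f : X -> Y) (g : Y -> X),
    [/\ continuous f, continuous g, cancel f g & cancel g f].

Definition retract_of (Q Z : topologicalType) : Prop :=
  exists (i : Q -> Z) (r : Z -> Q),
    [/\ continuous i, continuous r & cancel i r].

(* Ordinals are represented by well-ordered types; [well_order] asks that every
   nonempty subset have exactly one minimum, which makes [R] a total order. *)
Definition retract_of_cube (Q : topologicalType) : Prop :=
  exists (K : eqType) (R : rel K),
    well_order R /\ retract_of Q {ptws K -> bool}.

Definition metrizable (R : realType) (X : topologicalType) : Prop :=
  exists M : metricType R, homeomorphic X M.

Section Pi0.
Variable X : topologicalType.

Definition same_component : rel X :=
  fun x y => `[< connected_component [set: X] x y >].

Lemma same_component_equiv : equiv_class_of same_component.
Proof.
split=> [x | x y | y x z].
- exact/asboolP/connected_component_refl.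
- by apply/asboolP/asboolP; exact: connected_component_sym.
- by move=> /asboolP xy /asboolP yz; apply/asboolP/(connected_component_trans xy).
Qed.

Canonical same_component_equiv_rel := EquivRelPack same_component_equiv.

Definition pi0 : topologicalType :=
  quotient_topology {eq_quot same_component_equiv_rel}.

Definition to_pi0 (x : X) : pi0 :=
  \pi_{eq_quot same_component_equiv_rel} x.

Definition pi0_repr (c : pi0) : X :=
  repr (c : {eq_quot same_component_equiv_rel}).

Lemma pi0_reprK (c : pi0) : to_pi0 (pi0_repr c) = c.
Proof. exact: reprK. Qed.

Lemma to_pi0P (x y : X) :
  to_pi0 x = to_pi0 y <-> connected_component [set: X] x y.
Proof.
by split=> [/eqmodP/asboolP | /asboolP ?]; last exact/eqmodP.
Qed.

End Pi0.

(* The choice of representatives is immaterial for continuous [f]: see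
   [pi0_map_to_pi0]. *)
Definition pi0_map (X Y : topologicalType) (f : X -> Y) (c : pi0 X) : pi0 Y :=
  to_pi0 (f (pi0_repr c)).

Lemma pi0_map_to_pi0 (X Y : topologicalType) (f : X -> Y) (x : X) :
  continuous f -> pi0_map f (to_pi0 x) = to_pi0 (f x).
Proof.
move=> cf; apply/to_pi0P.
have /to_pi0P[C [Cr _ cC Cx]] : to_pi0 (pi0_repr (to_pi0 x)) = to_pi0 x.
  exact: pi0_reprK.
exists (f @` C); last by exists x.
split=> //.
exact/(connected_continuous_connected cC)/continuous_subspaceT.
Qed.

Record inverse_system := InverseSystem {
  index : Type;
  ile : index -> index -> Prop;
  ile_refl : forall i, ile i i;
  ile_trans : forall i j k, ile i j -> ile j k -> ile i k;
  index_nonempty : exists i : index, True;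
  ile_directed : forall i j, exists k, ile i k /\ ile j k;
  level : index -> topologicalType;
  bond : forall i j, ile i j -> level j -> level i;
  bond_continuous : forall i j (ij : ile i j), continuous (bond ij);
  bond_id : forall i (ii : ile i i), bond ii = id;
  bond_comp : forall i j k (ij : ile i j) (jk : ile j k) (ik : ile i k),
    bond ij \o bond jk = bond ik
}.

Definition inverse_limit (S : inverse_system) : set (prod_topology (@level S)) :=
  [set x | forall i j (ij : ile i j), bond ij (x j) = x i].
Arguments inverse_limit : clear implicits.

(* Empty levels are allowed, so the empty space is profinite. *)
Definition profinite (X : topologicalType) : Prop :=
  exists S : inverse_system,
    (forall i, finite_set [set: @level S i] /\ discrete_space (@level S i)) /\
    homeomorphic X (set_type (inverse_limit S)).

Definition tdch_space (X : topologicalType) : Prop :=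
  [/\ totally_disconnected [set: X], compact [set: X] & hausdorff_space X].

(* Main.v *)
(* A continuous map to the two-point space is a clopen subset, so [f] is in
   [delta_l] exactly when clopen subsets of the source extend along [f]; hence
   cubes [2^K] have the right lifting property against [delta_l], and the
   evaluation map [X -> 2^(clopens of X)] is itself in [delta_l]. Lifting the
   identity of [Q] along its evaluation map gives the retraction of (3), and
   pairing [f : X -> Y] with evaluation gives the factorization
   [X -> Y * 2^K -> Y] of (5). For (4), compact Hausdorff totally disconnected
   spaces are zero-dimensional because components are quasi-components, which
   presents them as the limit of their finite clopen partitions; a nonempty
   metrizable one is a retract of the Cantor set because [M * 2^nat] is
   perfect, hence homeomorphic to [2^nat]. *)
Require Import Defs.
From HB Require Import structures.
From mathcomp Require Import all_boot all_order all_algebra.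
From mathcomp Require Import all_classical all_reals all_analysis.
Set Implicit Arguments.
Unset Strict Implicit.
Unset Printing Implicit Defensive.
Local Open Scope classical_set_scope.

(** * Clopen subsets as continuous maps to the two-point space *)

Lemma clopen_bool (X : topologicalType) (t : X -> bool) (b : bool) :
  continuous t -> clopen (t @^-1` [set b]).
Proof.
by apply: preimage_clopen; split; [exact: discrete_open|exact: discrete_closed].
Qed.

Lemma locally_constant_continuous (X Y : topologicalType) (t : X -> Y) :
  (forall x, nbhs x (t @^-1` [set t x])) -> continuous t.
Proof.
move=> tx x V /nbhs_singleton Vtx; apply: filterS (tx x) => y /= ->; exact: Vtx.
Qed.

Lemma indicator_continuous (X : topologicalType) (U : set X) :
  clopen U -> continuous (fun x => `[< U x >]).
Proof.
move=> [oU cU]; apply: locally_constant_continuous => x.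
have [Ux|nUx] := pselect (U x).
  apply: (@filterS _ _ _ U); last exact: open_nbhs_nbhs.
  by move=> y Uy /=; rewrite !asboolT.
apply: (@filterS _ _ _ (~` U)); last first.
  by apply: open_nbhs_nbhs; rewrite /open_nbhs openC.
by move=> y Uy /=; rewrite !asboolF.
Qed.

Lemma to_point_continuous (X : topologicalType) : continuous (@to_point X).
Proof. exact: cst_continuous. Qed.

Lemma comp_to_point (X Y : topologicalType) (t : X -> Y)
    (s : X -> point_space) :
  @to_point Y \o t = s.
Proof. by apply/funext => x /=; case: (s x). Qed.

(** Squares over the point commute automatically, so lifting against [delta] only asks that each
    continuous [t : X -> bool], that is, the indicator of a clopen set, extend along [f]. *)
Lemma delta_lP (X Q : topologicalType) (f : X -> Q) :
  delta_l f <-> continuous f /\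
    forall U : set X, clopen U -> exists2 V : set Q, clopen V & U = f @^-1` V.
Proof.
split=> [[cf lf]|[cf lf]]; split=> //.
  move=> U cU.
  have [h [ch hf _]] := lf _ _ _ (Class1 delta) _ (@to_point Q)
    (indicator_continuous cU) (@to_point_continuous Q) (comp_to_point _ _).
  exists (h @^-1` [set true]); first exact: clopen_bool.
  by rewrite -comp_preimage hf; apply/seteqP; split=> x /= /asboolP.
move=> _ _ _ [] t s ct cs _.
have [V cV tV] := lf _ (clopen_bool true ct).
exists (fun q => `[< V q >]); split; [exact: indicator_continuous| |].
  apply/funext => x /=; apply/asboolP/idP => [Vfx|tx].
    by have : (f @^-1` V) x by []; rewrite -tV.
  by have : (t @^-1` [set true]) x by []; rewrite tV.
exact: comp_to_point.
Qed.

(** * Connectedness, components and membership in [delta_l] *)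

Lemma connected_clopen (X : topologicalType) (C U : set X) (x : X) :
  connected C -> clopen U -> C x -> U x -> C `<=` U.
Proof.
move=> conC [oU cU] Cx Ux; apply/setIidPl.
by apply: conC; [exists x|exists U|exists U].
Qed.

Lemma connected_delta_l (X Q : topologicalType) (f : X -> Q) :
  continuous f -> connected [set: X] -> delta_l f.
Proof.
move=> cf conX; apply/delta_lP; split=> // U cU.
have [[x Ux]|U0] := pselect (U !=set0).
  exists setT; first exact: clopenT.
  by apply/seteqP; split=> // y _; exact: (connected_clopen conX cU I Ux).
exists set0; first exact: clopen0.
by apply/seteqP; split=> // x Ux; apply: U0; exists x.
Qed.

Lemma delta_l_to_point (X : topologicalType) :
  connected [set: X] <-> delta_l (@to_point X).
Proof.
split=> [conX|/delta_lP[_ lX]].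
  by apply: connected_delta_l => //; exact: to_point_continuous.
move=> B [x Bx] [C oC BC] [D cD BD].
have [|V _ BV] := lX B.
  by split; [rewrite BC setTI|rewrite BD setTI].
apply/seteqP; split=> // y _; rewrite BV /=; suff -> : to_point y = to_point x.
  by rewrite BV in Bx.
by [].
Qed.

Lemma clopen_connected_component (X : topologicalType) (U : set X) (x y : X) :
  clopen U -> connected_component [set: X] x y -> U x -> U y.
Proof.
by move=> cU [C [Cx _ conC Cy]] Ux; exact: (connected_clopen conC cU Cx Ux).
Qed.

(** A clopen set contains every connected fibre that it meets, so it is saturated, and the quotient
    topology makes its image clopen. *)
Lemma quotient_delta_l (X Q : topologicalType) (f : X -> Q) :
  quotient_map f -> (forall q, connected (f @^-1` [set q])) -> delta_l f.
Proof.
move=> [cf _ qf] conf; apply/delta_lP; split=> // U cU.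
have sat : forall x y, f x = f y -> U x -> U y.
  move=> x y fxy Ux; apply: (connected_clopen (conf (f y)) cU _ Ux) => //.
have fU : f @^-1` (f @` U) = U.
  by apply/seteqP; split=> x /= => [[y Uy fy]|Ux]; [exact: sat Uy|exists x].
have fUC : f @^-1` (~` (f @` U)) = ~` U by rewrite -preimage_setC fU.
exists (f @` U) => //; split; first by apply: qf; rewrite fU; case: cU.
by rewrite -openC; apply: qf; rewrite fUC openC; case: cU.
Qed.

Lemma to_pi0_continuous (X : topologicalType) : continuous (@to_pi0 X).
Proof. exact: pi_continuous. Qed.

Lemma discrete_pi0_clopen (Q : topologicalType) (P : set (pi0 Q)) :
  discrete_space (pi0 Q) -> clopen (@to_pi0 Q @^-1` P).
Proof.
move=> dQ; apply: preimage_clopen; last exact: to_pi0_continuous.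
by split; [|rewrite -openC]; exact: dQ.
Qed.

Lemma delta_l_pi0 (X Q : topologicalType) (f : X -> Q) : continuous f ->
  discrete_space (pi0 Q) -> (delta_l f <-> injective (pi0_map f)).
Proof.
move=> cf dQ; split=> [/delta_lP[_ lf] c d|inj]; last first.
  apply/delta_lP; split=> // U cU.
  (* The union of the components of [Q] that meet the image of [U]; it is clopen because [pi0 Q] is
     discrete. *)
  exists (@to_pi0 Q @^-1` (@to_pi0 Q @` (f @` U))).
    exact: discrete_pi0_clopen.
  apply/seteqP; split=> [x Ux|x [_ [y Uy <-]]].
    by exists (f x) => //; exists x.
  rewrite -!pi0_map_to_pi0 // => /inj/to_pi0P yx.
  exact: (clopen_connected_component cU yx).
rewrite -(pi0_reprK c) -(pi0_reprK d) !pi0_map_to_pi0 //.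
set x := pi0_repr c; set y := pi0_repr d => fxy; apply/to_pi0P.
pose C := @to_pi0 Q @^-1` [set to_pi0 (f x)].
have cC : clopen C by exact: discrete_pi0_clopen.
(* The whole preimage of the component [C] is connected: since [C] is clopen, a relatively clopen
   part [B] is clopen in [X], hence the preimage of a clopen [V], and [V] contains [C] as soon as it
   meets it. *)
exists (f @^-1` C); last exact/esym.
split=> //.
move=> B [z Bz] [E oE BE] [D cD BD].
have clB : clopen B.
  have [oC clC] := preimage_clopen cC cf.
  by split; [rewrite BE; exact: openI|rewrite BD; exact: closedI].
have [V cV BV] := lf _ clB.
apply/seteqP; split; first by rewrite BE => ? [].
have Cz : C (f z) by move: Bz; rewrite BE => -[].
move=> w Cw; rewrite BV; apply: (@clopen_connected_component _ _ (f z)) => //.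
  by apply/to_pi0P; rewrite [RHS]Cw.
by rewrite BV in Bz.
Qed.

(** * Product topologies and the evaluation map into a cube *)

Lemma prod_topology_continuous (X : topologicalType) (I : Type)
    (K : I -> topologicalType) (g : X -> prod_topology K) :
  (forall i, continuous (fun x => g x i)) -> continuous g.
Proof.
move=> cg x; apply/cvg_sup => i U [V [[W oW <-] Wgx] VU].
apply: filterS VU _; apply: (cg i x W).
by apply: open_nbhs_nbhs; split.
Qed.

Lemma prod_topology_proj_continuous (I : Type) (K : I -> topologicalType)
    (i : I) :
  continuous (fun x : prod_topology K => x i).
Proof. exact: (@proj_continuous {classic I} K i). Qed.

(* Discontinuous [t] get the constant coordinate [false], which allows indexing
   the cube by the plain type [X -> bool]. *)
Definition eval_bool (X : topologicalType) : X -> {ptws (X -> bool) -> bool} :=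
  fun x t => `[< continuous t >] && t x.

Lemma eval_bool_coord_continuous (X : topologicalType) (t : X -> bool) :
  continuous (fun x => eval_bool x t).
Proof.
rewrite /eval_bool; case: asboolP => //= _; exact: cst_continuous.
Qed.

Lemma eval_bool_continuous (X : topologicalType) : continuous (@eval_bool X).
Proof. exact/prod_topology_continuous/eval_bool_coord_continuous. Qed.

(** A clopen [U] is cut out by the coordinate indexed by its own indicator function. *)
Lemma eval_bool_delta_l (X : topologicalType) : delta_l (@eval_bool X).
Proof.
apply/delta_lP; split=> [|U /indicator_continuous cU].
  exact: eval_bool_continuous.
exists ((fun x => x (fun x => `[< U x >])) @^-1` [set true]).
  exact/clopen_bool/prod_topology_proj_continuous.
by apply/seteqP; split=> x /=; rewrite /eval_bool asboolT //= => /asboolP.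
Qed.

(** * Extension along [delta_l], the factorization, and retracts of cubes *)

Lemma delta_l_extend_bool (A B : topologicalType) (f : A -> B) (t : A -> bool) :
  delta_l f -> continuous t -> exists2 h : B -> bool, continuous h & h \o f = t.
Proof.
move=> [_ lf] ct.
have [h [ch hf _]] := lf _ _ _ (Class1 delta) t (@to_point B) ct
  (@to_point_continuous B) (comp_to_point _ _).
by exists h.
Qed.

Lemma delta_l_extend_cube (A B : topologicalType) (K : Type) (f : A -> B)
    (t : A -> {ptws K -> bool}) : delta_l f -> continuous t ->
  exists2 h : B -> {ptws K -> bool}, continuous h & h \o f = t.
Proof.
move=> lf ct.
have /choice[h hP] : forall k, exists h : B -> bool,
    continuous h /\ h \o f = (fun a => t a k).
  move=> k; have [|h ch hf] := @delta_l_extend_bool _ _ f (fun a => t a k) lf.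
    move=> a; apply: (@continuous_comp _ _ _ t (fun x => x k)); first exact: ct.
    exact: prod_topology_proj_continuous.
  by exists h.
exists (fun b k => h k b).
  by apply: prod_topology_continuous => k; case: (hP k).
by apply/funext => a; apply/funext => k; have [_ /(congr1 (@^~ a))] := hP k.
Qed.

Lemma pair_continuous (X Y Z : topologicalType) (f : X -> Y) (g : X -> Z) :
  continuous f -> continuous g -> continuous (fun x => (f x, g x)).
Proof.
move=> cf cg x.
by apply: (@cvg_pair _ _ _ _ (nbhs (f x)) (nbhs (g x))); [exact: cf|exact: cg].
Qed.

(** The first coordinate of a lift is dictated by [s]; only the cube coordinate has to be
    extended. *)
Lemma fst_delta_lr (Y : topologicalType) (K : Type) :
  delta_lr (fst : Y * {ptws K -> bool} -> Y).
Proof.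
split=> [p|A B f lf t s ct cs ts]; first exact: cvg_fst.
have [|h ch hf] := @delta_l_extend_cube _ _ _ f (snd \o t) lf.
  by move=> a; apply: continuous_comp; [exact: ct|exact: cvg_snd].
exists (fun b => (s b, h b)); split=> //.
  exact: pair_continuous.
apply/funext => a /=; rewrite [RHS]surjective_pairing; congr pair.
  exact/esym/(congr1 (@^~ a) ts).
exact: (congr1 (@^~ a) hf).
Qed.

Lemma delta_l_delta_lr_factor (X Y : topologicalType) (f : X -> Y) :
  continuous f -> exists (Q : topologicalType) (fl : X -> Q) (flr : Q -> Y),
    [/\ f = flr \o fl, delta_l fl & delta_lr flr].
Proof.
move=> cf.
exists (Y * {ptws (X -> bool) -> bool})%type.
exists (fun x => (f x, eval_bool x)), fst.
split=> //; last exact: fst_delta_lr.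
have /delta_lP[_ lE] := @eval_bool_delta_l X.
apply/delta_lP; split=> [|U /lE[V cV ->]].
  by apply: pair_continuous => //; exact: eval_bool_continuous.
(* Evaluation alone already realizes every clopen set, so the added coordinate [f x] does no
   harm. *)
exists (snd @^-1` V) => //; apply: preimage_clopen => // p; exact: cvg_snd.
Qed.

Lemma delta_lr_to_pointP (Q : topologicalType) :
  delta_lr (@to_point Q) <->
  forall (A B : topologicalType) (f : A -> B) (t : A -> Q),
    delta_l f -> continuous t -> exists2 h : B -> Q, continuous h & h \o f = t.
Proof.
split=> [[_ rQ] A B f t lf ct|rQ].
  have [h [ch hf _]] := rQ _ _ _ lf t (@to_point B) ct
    (@to_point_continuous B) (comp_to_point _ _).
  by exists h.
split=> [|A B f lf t s ct _ _]; first exact: to_point_continuous.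
have [h ch hf] := rQ _ _ _ _ lf ct.
by exists h; split=> //; exact: comp_to_point.
Qed.

Lemma retract_cube_delta_lr (Q : topologicalType) (K : Type) :
  retract_of Q {ptws K -> bool} -> delta_lr (@to_point Q).
Proof.
move=> [i [r [ci cr ir]]]; apply/delta_lr_to_pointP => A B f t lf ct.
have [|h ch hf] := @delta_l_extend_cube _ _ _ f (i \o t) lf.
  by move=> a; apply: continuous_comp; [exact: ct|exact: ci].
exists (r \o h).
  by move=> b; apply: continuous_comp; [exact: ch|exact: cr].
by rewrite -compA hf; apply/funext => a /=; rewrite ir.
Qed.

Lemma delta_lr_retract_cube (Q : topologicalType) :
  delta_lr (@to_point Q) -> retract_of Q {ptws (Q -> bool) -> bool}.
Proof.
move=> /delta_lr_to_pointP rQ.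
have [|r cr ri] := rQ _ _ _ id (@eval_bool_delta_l Q).
  by move=> x; exact: cvg_id.
exists (@eval_bool Q), r; split=> //; first exact: eval_bool_continuous.
by move=> x; exact: (congr1 (@^~ x) ri).
Qed.

Lemma retract_of_cubeP (Q : topologicalType) :
  retract_of_cube Q <-> delta_lr (@to_point Q).
Proof.
split=> [[K [_ [_ /retract_cube_delta_lr]]]|/delta_lr_retract_cube rQ] //.
(* A well-order on the exponent turns it into an ordinal; the cube itself does not depend on the
   order. *)
have [W Wwo] := wochoice.well_ordering_principle (Q -> bool).
by exists (Q -> bool)%type, W.
Qed.

(** * Zero-dimensionality, in the sense that clopen sets separate points, and compactness *)

Lemma zero_dimensional_inj (X Y : topologicalType) (f : X -> Y) :
  continuous f -> injective f -> zero_dimensional Y -> zero_dimensional X.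
Proof.
move=> cf fI zY x y /eqP xy.
have [|U [cU Ux Uy]] := zY (f x) (f y); first by apply/eqP => /fI.
by exists (f @^-1` U); split=> //; exact: preimage_clopen.
Qed.

Lemma zero_dimensional_prod_topology (I : Type) (K : I -> topologicalType) :
  (forall i, zero_dimensional (K i)) -> zero_dimensional (prod_topology K).
Proof. exact: (@zero_dimension_prod {classic I} K). Qed.

Lemma zero_dimensional_hausdorff (X : topologicalType) :
  zero_dimensional X -> hausdorff_space X.
Proof.
move=> zX x y xy; apply: contrapT => /eqP /zX[U [[oU cU] Ux Uy]].
have [||z [Uz /(_ Uz)]] := xy U (~` U) => //; first exact: open_nbhs_nbhs.
by apply: open_nbhs_nbhs; rewrite /open_nbhs openC.
Qed.

Lemma compact_prod_topology (I : Type) (K : I -> topologicalType) :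
  (forall i, compact [set: K i]) -> compact [set: prod_topology K].
Proof.
move=> cK; have := @tychonoff {classic I} K (fun=> setT) cK.
by congr (compact _); apply/seteqP.
Qed.

(** The pushforward of a filter on the subtype has a cluster point in [A], which also clusters
    upstairs because open sets of the subtype are traces of open sets of [X]. *)
Lemma compact_set_type (X : topologicalType) (A : set X) :
  compact A -> compact [set: set_type A].
Proof.
move=> cA F PF _; have AT x : A (set_val (x : A)) by exact: set_valP.
have [|p [Ap Fp]] := cA (set_val @ F) _.
  have AE : @set_val X A @^-1` A = setT.
    by apply/seteqP; split=> x _ //; exact: AT.
  by rewrite /fmap /= nbhs_simpl AE; exact: filterT.
exists (SigSub (mem_set Ap)); split=> // B C FB [W [[V oV VW] Wp] WC].
have [||_ [[x Bx <-] Vx]] := Fp (@set_val X A @` B) V.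
- by rewrite /fmap /= nbhs_simpl; apply: filterS FB => x Bx; exists x.
- by apply: open_nbhs_nbhs; split => //; rewrite -VW in Wp.
by exists x; split=> //; apply: WC; rewrite -VW.
Qed.

Lemma homeomorphic_sym (X Y : topologicalType) :
  homeomorphic X Y -> homeomorphic Y X.
Proof. by move=> [f [g [cf cg fK gK]]]; exists g, f. Qed.

Lemma homeomorphic_compact (X Y : topologicalType) :
  homeomorphic X Y -> compact [set: Y] -> compact [set: X].
Proof.
move=> [f [g [_ cg fK _]]] cY.
suff -> : [set: X] = g @` [set: Y].
  by apply: continuous_compact => //; exact: continuous_subspaceT.
by apply/seteqP; split=> // x _; exists (f x).
Qed.

(** Such an [f] is a closed map: closed sets are compact, and their compact images are closed in a
    Hausdorff space. *)
Lemma compact_hausdorff_homeomorphic (X Y : topologicalType) (f : X -> Y) :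
  compact [set: X] -> hausdorff_space Y -> continuous f -> injective f ->
  (forall y, exists x, f x = y) -> homeomorphic X Y.
Proof.
move=> cX hY cf fI /choice[g fg]; exists f, g.
split=> //; last by move=> x; exact: fI.
apply/continuous_closedP => A clA.
have -> : g @^-1` A = f @` A.
  apply/seteqP; split=> [y Agy|y [x Ax <-]]; first by exists (g y).
  by rewrite /= (fI _ _ (fg (f x))).
apply: compact_closed => //; apply: continuous_compact.
  exact: continuous_subspaceT.
exact: (subclosed_compact clA cX).
Qed.

Lemma zero_dimensional_tdch (X : topologicalType) :
  zero_dimensional X -> compact [set: X] -> tdch_space X.
Proof.
move=> zX cX; split=> //; first exact: zero_dimension_totally_disconnected.
exact: zero_dimensional_hausdorff.
Qed.

Lemma retract_cube_tdch (Q : topologicalType) (K : Type) :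
  retract_of Q {ptws K -> bool} -> tdch_space Q.
Proof.
move=> [i [r [ci cr ir]]]; apply: zero_dimensional_tdch.
  apply: (zero_dimensional_inj ci (can_inj ir)).
  by apply: zero_dimensional_prod_topology => _; exact: discrete_zero_dimension.
have -> : [set: Q] = r @` setT by apply/seteqP; split=> // x _; exists (i x).
apply: continuous_compact; first exact: continuous_subspaceT.
by apply: compact_prod_topology => _; exact: bool_compact.
Qed.

(** * Quasi-components of compact Hausdorff spaces *)

Definition quasi_component (X : topologicalType) (x : X) : set X :=
  \bigcap_(D in [set D : set X | clopen D /\ D x]) D.

(** Otherwise the traces on [K] of the clopen sets around [x] generate a proper filter; its cluster
    point in [K] lies in all these sets, since they are closed, hence in the quasi-component. *)
Lemma quasi_component_compact (X : topologicalType) (x : X) (K : set X) :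
  compact K -> K `&` quasi_component x = set0 ->
  exists D, [/\ clopen D, D x & D `&` K = set0].
Proof.
move=> cK K0; apply: contrapT => nD.
pose F := filter_from [set D : set X | clopen D /\ D x] (fun D => D `&` K).
have FF : ProperFilter F.
  apply: filter_from_proper; first apply: filter_from_filter.
  - by exists setT; split=> //; exact: clopenT.
  - move=> A B [cA Ax] [cB Bx]; exists (A `&` B).
      by split=> //; exact: clopenI.
    by move=> y [[? ?] ?].
  - move=> D [cD Dx]; apply/set0P/eqP => DK0; apply: nD; by exists D.
have FK : F K by exists setT; [split=> //; exact: clopenT|move=> y []].
have [p [Kp Fp]] := cK F FF FK.
suff : (K `&` quasi_component x) p by rewrite K0.
split=> // D [cD Dx]; apply: cD.2 => V Vp.
by apply: Fp => //; exists D => // y [].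
Qed.

Lemma quasi_component_closed (X : topologicalType) (x : X) :
  closed (quasi_component x).
Proof. by apply: closed_bigI => D [[]]. Qed.

(* If the quasi-component splits into disjoint closed pieces, an open
   neighbourhood [O] of the piece through [x] with closure off the other piece
   has its boundary off the quasi-component, so by compactness some clopen [D]
   around [x] avoids that boundary and [D `&` O] is clopen. *)
Lemma quasi_component_connected (X : topologicalType) (x : X) :
  hausdorff_space X -> compact [set: X] -> connected (quasi_component x).
Proof.
move=> hX cX; apply/connectedP => E [E0 EC [sE1 sE2]].
have Qx : quasi_component x x by move=> D [].
have clE b : closed (E b).
  move=> y Ey.
  have : quasi_component x y.
    apply: quasi_component_closed; apply: closureS Ey.
    by rewrite EC; case: b; [exact: subsetUr|exact: subsetUl].
  rewrite EC; case: b Ey => Ey [] // Ey'.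
    by have : (E false `&` closure (E true)) y by []; rewrite sE2.
  by have : (closure (E false) `&` E true) y by []; rewrite sE1.
have Ed b y : E b y -> ~ E (~~ b) y.
  case: b => /= Ey Ey'.
    have : (closure (E false) `&` E true) y.
      by split=> //; exact: subset_closure.
    by rewrite sE1.
  have : (E false `&` closure (E true)) y by split=> //; exact: subset_closure.
  by rewrite sE2.
have [b Ebx] : exists b, E b x by move: Qx; rewrite EC => -[]; eexists; eauto.
have [z Ez] := E0 (~~ b).
have nX := compact_normal hX cX.
have [|A] := nX _ (clE b) (~` E (~~ b)).
  apply/set_nbhsP; exists (~` E (~~ b)).
  by split=> //; [exact: closed_openC|exact: Ed].
move=> /set_nbhsP[ O [oO EO OA]] AE.
have OE : closure O `<=` ~` E (~~ b) by apply: subset_trans AE; exact: closureS.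
have [||D [[oD cD] Dx D0]] := @quasi_component_compact _ x (closure O `\` O).
- by apply: (subclosed_compact _ cX) => //; rewrite setDE; apply: closedI;
  [exact: closed_closure|exact: open_closedC].
- apply/seteqP; split=> // y [[cOy Oy]]; rewrite EC => Ey.
  have : E b y \/ E (~~ b) y.
    by case: b {clE Ed Ebx Ez EO OE AE}; case: Ey; auto.
  by case=> [/EO|/(OE _ cOy)].
have DO : D `&` O = D `&` closure O.
  apply/seteqP; split=> y [Dy Oy]; split=> //; first exact: subset_closure.
  apply: contrapT => nOy.
  by have : (D `&` (closure O `\` O)) y by []; rewrite D0.
have clDO : clopen (D `&` O).
  split; first exact: openI.
  by rewrite DO; apply: closedI => //; exact: closed_closure.
have Qz : quasi_component x z.
  by rewrite EC; case: b Ez {Ebx EO OE AE}; [left|right].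
have [_ Oz] : (D `&` O) z by apply: Qz; split=> //; split=> //; exact: EO.
by apply: (OE z); [exact: subset_closure|].
Qed.

(** A point [y] that no clopen set separates from [x] lies in the connected quasi-component of [x],
    hence in its component, which is a singleton. *)
Lemma tdch_zero_dimensional (X : topologicalType) :
  tdch_space X -> zero_dimensional X.
Proof.
move=> [tdX cX hX] x y /eqP xy; apply: contrapT => nU; apply: xy.
suff : connected_component [set: X] x y by rewrite tdX.
exists (quasi_component x); last first.
  by move=> U [cU Ux]; apply: contrapT => ?; apply: nU; exists U.
by split=> //; [move=> D []|exact: quasi_component_connected].
Qed.

(** * Inverse limits of discrete spaces *)

Lemma discrete_space_clopen (X : topologicalType) (A : set X) :
  discrete_space X -> clopen A.
Proof. by move=> dX; split; [|rewrite -openC]; exact: dX. Qed.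

Lemma discrete_space_zero_dimensional (X : topologicalType) :
  discrete_space X -> zero_dimensional X.
Proof.
move=> dX x y xy; exists [set x]; split=> //.
  exact: discrete_space_clopen.
exact/nesym/eqP.
Qed.

(** Each compatibility equation involves two coordinates, both locally constant because the levels
    are discrete, so its failure is an open condition. *)
Lemma inverse_limit_closed (S : inverse_system) :
  (forall i, discrete_space (@level S i)) -> closed (inverse_limit S).
Proof.
move=> dS.
have -> : inverse_limit S = \bigcap_i \bigcap_j \bigcap_(ij : ile i j)
    [set x : prod_topology (@level S) | bond ij (x j) = x i].
  by apply/seteqP; split=> x xS;
    [move=> i _ j _ ij _; exact: xS|move=> i j ij; exact: (xS i I j I ij I)].
apply: closed_bigI => i _; apply: closed_bigI => j _.
apply: closed_bigI => ij _.
rewrite -openC openE => x /= xij.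
have pr k : nbhs x [set y : prod_topology (@level S) | y k = x k].
  apply: (@prod_topology_proj_continuous _ (@level S) k x [set x k]).
  by apply: open_nbhs_nbhs; split=> //; exact: dS.
by apply: filterS (filterI (pr i) (pr j)) => y [yi yj]; rewrite /= yi yj.
Qed.

Lemma inverse_limit_zero_dimensional (S : inverse_system) :
  (forall i, discrete_space (@level S i)) -> zero_dimensional (inverse_limit S).
Proof.
move=> dS; apply: (@zero_dimensional_inj _ _ (@set_val _ (inverse_limit S))).
- exact: initial_continuous.
- exact: val_inj.
- apply: zero_dimensional_prod_topology => i.
  exact: discrete_space_zero_dimensional.
Qed.

Lemma profinite_zero_dimensional (X : topologicalType) :
  profinite X -> zero_dimensional X.
Proof.
move=> [S [fS [f [g [cf cg fK gK]]]]].
apply: (zero_dimensional_inj cf (can_inj fK)).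
by apply: inverse_limit_zero_dimensional => i; case: (fS i).
Qed.

Lemma profinite_tdch (X : topologicalType) : profinite X -> tdch_space X.
Proof.
move=> pX; apply: zero_dimensional_tdch.
  exact: profinite_zero_dimensional.
have [S [fS homS]] := pX; apply: (homeomorphic_compact homS).
apply: compact_set_type.
apply: (@subclosed_compact _ _ setT) => //.
  by apply: inverse_limit_closed => i; case: (fS i).
by apply: compact_prod_topology => i; apply: finite_compact; case: (fS i).
Qed.

(** * The inverse system of finite clopen partitions of a space *)

Section finite_quotients.
Variable X : topologicalType.

(** Encodes a finite clopen partition, whose cells are the fibres of the labelling. *)
Definition finite_labelling :=
  {t : X -> nat | continuous t /\ finite_set (range t)}.

(** It is the second argument [t] that refines [s], so bonds run from the cells of [t] to those of
    [s]. *)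
Definition finer (s t : finite_labelling) : Prop :=
  forall x y, sval t x = sval t y -> sval s x = sval s y.

(** Keeping only the labels that occur makes [fibre] surjective, so every cell has a
    representative. *)
Definition fibres (t : finite_labelling) : topologicalType :=
  discrete_topology (range (sval t)).

Definition fibre (t : finite_labelling) (x : X) : fibres t :=
  SigSub (mem_set (imageT (sval t) x)).

Lemma fibre_eq (t : finite_labelling) (x y : X) :
  fibre t x = fibre t y <-> sval t x = sval t y.
Proof. by split=> [/(congr1 val)|xy] //; exact: val_inj. Qed.

Lemma fibre_surj (t : finite_labelling) (c : fibres t) :
  exists x, fibre t x = c.
Proof.
have [x _ xc] : range (sval t) (val c) by exact: set_valP.
by exists x; apply: val_inj.
Qed.

Definition fibre_repr (t : finite_labelling) (c : fibres t) : X :=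
  sval (cid (fibre_surj c)).

Lemma fibre_reprK (t : finite_labelling) (c : fibres t) :
  fibre t (fibre_repr c) = c.
Proof. exact: svalP (cid (fibre_surj c)). Qed.

(** By [merge_fibresE] the chosen representative is immaterial. *)
Definition merge_fibres (s t : finite_labelling) (st : finer s t)
    (c : fibres t) : fibres s := fibre s (fibre_repr c).

Lemma merge_fibresE (s t : finite_labelling) (st : finer s t) (x : X) :
  merge_fibres st (fibre t x) = fibre s x.
Proof. by apply/fibre_eq/st/fibre_eq; exact: fibre_reprK. Qed.

Lemma finite_labelling_directed (s t : finite_labelling) :
  exists u, finer s u /\ finer t u.
Proof.
case: s t => [s [cs fs]] [t [ct ft]].
(* The common refinement is labelled by pairs, which [pickle] codes back into [nat]. *)
pose u x := pickle (s x, t x).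
have uP x y : u x = u y -> s x = s y /\ t x = t y.
  by move=> /(pcan_inj pickleK) [-> ->].
have cu : continuous u.
  apply: locally_constant_continuous => x.
  have sx : nbhs x (s @^-1` [set s x]) := cs x _ (discrete_set1 _).
  have tx : nbhs x (t @^-1` [set t x]) := ct x _ (discrete_set1 _).
  by apply: filterS (filterI sx tx) => y [/= sy ty]; rewrite /u sy ty.
have fu : finite_set (range u).
  apply: (sub_finite_set _ (finite_image pickle (finite_setX fs ft))).
  by move=> _ [x _ <-]; exists (s x, t x) => //; split; exists x.
by exists (exist _ u (conj cu fu)); split=> x y /uP [].
Qed.

Lemma fibres_discrete (t : finite_labelling) : discrete_space (fibres t).
Proof. by move=> A; exact: discrete_open. Qed.

Lemma fibres_finite (t : finite_labelling) : finite_set [set: fibres t].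
Proof.
have [_ ft] := svalP t.
by rewrite (eq_finite_set (card_setT _)).
Qed.

Lemma merge_fibres_continuous (s t : finite_labelling) (st : finer s t) :
  continuous (merge_fibres st).
Proof. by apply/continuousP => A _; exact: fibres_discrete. Qed.

Lemma merge_fibres_id (t : finite_labelling) (t_t : finer t t) :
  merge_fibres t_t = id.
Proof. by apply/funext => c; exact: fibre_reprK. Qed.

Lemma merge_fibres_comp (s t u : finite_labelling)
    (st : finer s t) (tu : finer t u) (su : finer s u) :
  merge_fibres st \o merge_fibres tu = merge_fibres su.
Proof. by apply/funext => c; exact: merge_fibresE. Qed.

Lemma fibre_continuous (t : finite_labelling) : continuous (fibre t).
Proof.
apply: locally_constant_continuous => x.
have [ct _] := svalP t.
have tx : nbhs x (sval t @^-1` [set sval t x]) := ct x _ (discrete_set1 _).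
by apply: filterS tx => y /fibre_eq.
Qed.

Lemma constant_labelling : finite_labelling.
Proof.
exists (fun=> 0%N); split; first exact: cst_continuous.
by apply: (sub_finite_set _ (finite_set1 0%N)) => _ [x _ <-].
Qed.

Definition fibre_system : inverse_system := @InverseSystem
  finite_labelling finer
  (fun t x y xy => xy) (fun s t u st tu x y xy => st x y (tu x y xy))
  (ex_intro _ constant_labelling I) finite_labelling_directed
  fibres merge_fibres merge_fibres_continuous merge_fibres_id merge_fibres_comp.

Lemma inverse_limit_fibre (x : X) :
  inverse_limit fibre_system (fun t => fibre t x).
Proof. by move=> s t st; exact: merge_fibresE. Qed.

Definition fibre_family (x : X) : inverse_limit fibre_system :=
  SigSub (mem_set (inverse_limit_fibre x)).

Lemma fibre_family_continuous : continuous fibre_family.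
Proof.
apply: continuous_comp_initial.
by apply: prod_topology_continuous => t; exact: fibre_continuous.
Qed.

Lemma fibre_family_inj : zero_dimensional X -> injective fibre_family.
Proof.
move=> zX x y xy; apply: contrapT => /eqP /zX[U [cU Ux Uy]].
(* The two-cell partition into [U] and its complement already distinguishes [x] from [y]. *)
pose t z : nat := `[< U z >].
have ct : continuous t.
  apply: locally_constant_continuous => z.
  have Uz : nbhs z ((fun w => `[< U w >]) @^-1` [set `[< U z >]]).
    exact: (indicator_continuous cU (discrete_set1 _)).
  by apply: filterS Uz => w /= Uwz; rewrite /t Uwz.
have ft : finite_set (range t).
  apply: (sub_finite_set _ (finite_set2 0%N 1%N)) => _ [z _ <-].
  by rewrite /t; case: asboolP => _; [right|left].
pose l : finite_labelling := exist _ t (conj ct ft).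
have /fibre_eq : fibre l x = fibre l y by exact: (congr1 (fun c => val c l) xy).
by rewrite /= /t asboolT // asboolF.
Qed.

(** The cells selected by [c] are non-empty and directed, so by compactness they have a cluster
    point [x]; each cell is closed and therefore contains [x]. *)
Lemma fibre_family_surj (c : inverse_limit fibre_system) :
  compact [set: X] -> exists x, fibre_family x = c.
Proof.
move=> cX; pose F := filter_from [set: finite_labelling]
  (fun t => [set x | fibre t x = val c t]).
have FF : ProperFilter F.
  apply: filter_from_proper; first apply: filter_from_filter.
  - by exists constant_labelling.
  - move=> s t _ _; have [u [su tu]] := finite_labelling_directed s t.
    exists u => // x ux; split=> /=.
      by rewrite -(merge_fibresE su) ux; exact: (set_valP c).
    by rewrite -(merge_fibresE tu) ux; exact: (set_valP c).
  - by move=> t _; exact: fibre_surj.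
have [x [_ Fx]] := cX F FF filterT.
exists x; apply: val_inj; apply/functional_extensionality_dep => t.
(* The cell of [x] is an open neighbourhood of [x], so it meets the cell selected by [c] at some
   [y], and the two cells coincide. *)
have [||y [/= yt <-]] 
  := Fx [set x | fibre t x = val c t] [set y | fibre t y = fibre t x].
- by exists t.
- apply: (@fibre_continuous t x [set fibre t x]).
  by apply: open_nbhs_nbhs; split=> //; exact: fibres_discrete.
by rewrite /= yt.
Qed.

End finite_quotients.

Lemma tdch_profinite (X : topologicalType) : tdch_space X -> profinite X.
Proof.
move=> tX; have zX := tdch_zero_dimensional tX; have [_ cX _] := tX.
exists (fibre_system X); split=> [t|].
  by split; [exact: fibres_finite|exact: fibres_discrete].
apply: (@compact_hausdorff_homeomorphic _ _ (@fibre_family X)) => //.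
- apply: zero_dimensional_hausdorff; apply: inverse_limit_zero_dimensional => t.
  exact: fibres_discrete.
- exact: fibre_family_continuous.
- exact: fibre_family_inj.
- by move=> c; exact: fibre_family_surj.
Qed.

(** * Metrizable spaces as retracts of the Cantor set *)

Lemma zero_dimensional_prod (X Y : topologicalType) :
  zero_dimensional X -> zero_dimensional Y -> zero_dimensional (X * Y)%type.
Proof.
move=> zX zY [x1 y1] [x2 y2]; rewrite xpair_eqE negb_and.
move=> /orP[/zX|/zY] [U [cU U1 U2]].
  exists (fst @^-1` U); split=> //.
  by apply: preimage_clopen => // p; exact: cvg_fst.
exists (snd @^-1` U); split=> //.
by apply: preimage_clopen => // p; exact: cvg_snd.
Qed.

(** The Cantor factor removes isolated points: an open singleton would project to an open singleton
    of the perfect space [cantor_space]. *)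
Lemma cantor_like_prod_cantor (X : topologicalType) :
  compact [set: X] -> zero_dimensional X -> cantor_like (X * cantor_space)%type.
Proof.
move=> cX zX.
have zXC : zero_dimensional (X * cantor_space)%type.
  exact: (zero_dimensional_prod zX cantor_zero_dimensional).
split=> //.
- apply/perfectTP => -[x c] /snd_open; rewrite image_set1.
  by apply: (iffLR perfectTP cantor_perfect).
- by rewrite -setXTT; exact: (compact_setX cX cantor_space_compact).
- exact: zero_dimensional_hausdorff.
Qed.

Lemma retract_of_homeomorphic (X Y Z : topologicalType) :
  homeomorphic X Y -> retract_of Y Z -> retract_of X Z.
Proof.
move=> [f [g [cf cg fK gK]]] [i [r [ci cr ir]]].
exists (i \o f), (g \o r); split.
- by move=> x; apply: continuous_comp; [exact: cf|exact: ci].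
- by move=> x; apply: continuous_comp; [exact: cr|exact: cg].
- by move=> x /=; rewrite ir.
Qed.

Lemma metric_retract_cantor (R : realType) (M : pseudoMetricType R) (x0 : M) :
  compact [set: M] -> zero_dimensional M -> retract_of M {ptws nat -> bool}.
Proof.
move=> cM zM; have MC := cantor_like_prod_cantor cM zM.
(* Non-emptiness enters here: [x0] provides the base point of the pointed structure. *)
pose P : pseudoPMetricType R := HB.pack (M * {ptws nat -> bool})%type
  (isPointed.Build (M * {ptws nat -> bool})%type (x0, fun=> true)).
have [f [cf clf]] := @homeomorphism_cantor_like R P MC.
have fK : cancel f f^-1%FUN by move=> x; apply: funK; rewrite inE.
have gK : cancel f^-1%FUN f by move=> x; apply: invK; rewrite inE.
have cg : continuous f^-1%FUN.
  apply/continuous_closedP => A clA.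
  have -> : f^-1%FUN @^-1` A = f @` A.
    apply/seteqP; split=> [x Ax|_ [x Ax <-]] /=; last by rewrite fK.
    by exists (f^-1%FUN x).
  exact: clf.
(* [M] sits in the Cantor set as the slice of the product over the constant sequence [true], and the
   first projection retracts onto it. *)
exists (fun x => f^-1%FUN (x, fun=> true)), (fst \o f); split.
- have cpair : continuous (fun x => (x, fun=> true) : M * {ptws nat -> bool}).
    by apply: pair_continuous; [move=> ?; exact: cvg_id|exact: cst_continuous].
  move=> x; exact: (continuous_comp (cpair x) (cg _)).
- by move=> x; apply: continuous_comp; [exact: cf|exact: cvg_fst].
- by move=> x /=; rewrite gK.
Qed.

Lemma metrizable_tdch_delta_lr (R : realType) (Q : topologicalType) :
  metrizable R Q -> [set: Q] !=set0 -> tdch_space Q -> delta_lr (@to_point Q).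
Proof.
move=> [M QM] [x _] tQ; have [_ cQ _] := tQ.
have zQ := tdch_zero_dimensional tQ.
apply: (@retract_cube_delta_lr _ nat); apply: (retract_of_homeomorphic QM).
have MQ := homeomorphic_sym QM.
have cM := homeomorphic_compact MQ cQ.
have zM : zero_dimensional M.
  have [g [f [cg _ gK _]]] := MQ.
  exact: (zero_dimensional_inj cg (can_inj gK) zQ).
have [f _] := QM.
exact: (metric_retract_cantor (f x) cM zM).
Qed.

(** Non-emptiness in (4) excludes the empty space, which is profinite although its map to the point
    is not in [delta_lr]: that map lies in [delta_l] and has no lift against itself. *)
Theorem proposition2p5 (R : realType) :
  (* (1) *)
  (forall X : topologicalType,
     connected [set: X] <-> delta_l (@to_point X)) /\
  (* (2) *)
  (forall (X Q : topologicalType) (f : X -> Q), continuous f ->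
     [/\ delta_l f <->
           (forall U : set X, clopen U ->
              exists2 V : set Q, clopen V & U = f @^-1` V),
         connected [set: X] \/
           (quotient_map f /\ forall q : Q, connected (f @^-1` [set q])) ->
           delta_l f
       & discrete_space (pi0 Q) -> (delta_l f <-> injective (pi0_map f))]) /\
  (* (3) *)
  (forall Q : topologicalType,
     (retract_of_cube Q <-> delta_lr (@to_point Q)) /\
     (delta_lr (@to_point Q) -> tdch_space Q)) /\
  (* (4) *)
  (forall Q : topologicalType, metrizable R Q ->
     (profinite Q <-> tdch_space Q) /\
     ([set: Q] !=set0 -> (profinite Q <-> delta_lr (@to_point Q)))) /\
  (* (5) *)
  (forall (X Y : topologicalType) (f : X -> Y), continuous f ->
     exists (Q : topologicalType) (fl : X -> Q) (flr : Q -> Y),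
       [/\ f = flr \o fl, delta_l fl & delta_lr flr]).
Proof.
have lr_tdch Q : delta_lr (@to_point Q) -> tdch_space Q.
  by move=> /delta_lr_retract_cube; exact: retract_cube_tdch.
split; [exact: delta_l_to_point|split; [|split; [|split]]].
- move=> X Q f cf; split; last exact: delta_l_pi0.
    by split=> [/delta_lP[]//|lf]; apply/delta_lP; split.
  by case=> [|[]]; [exact: connected_delta_l|exact: quotient_delta_l].
- by move=> Q; split; [exact: retract_of_cubeP|exact: lr_tdch].
- move=> Q mQ; split.
    by split; [exact: profinite_tdch|exact: tdch_profinite].
  move=> Q0; split=> [/profinite_tdch|/lr_tdch/tdch_profinite] //.
  exact: (metrizable_tdch_delta_lr mQ Q0).
- exact: delta_l_delta_lr_factor.
Qed.
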